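(* Consider the online vector scheduling problem on identical machines with all $L_r$-norm objectives (VSALL-I), as defined in the context. Then: (i) There is an online algorithm for VSALL-I that simultaneously, for every $r\ge1$, obtains a competitive ratio of $O\left(\left(\frac{\log d}{\log \log d}\right)^{\frac{r-1}{r}}\right)$ for the $L_r$ norm in every dimension. (ii) These ratios are tight: for every fixed $r\ge1$, any online algorithm for minimizing the $L_r$ norm of the machine loads (in every dimension) in vector scheduling on identical machines has competitive ratio $\Omega\left(\left(\frac{\log d}{\log \log d}\right)^{\frac{r-1}{r}}\right)$.
   Context: Online vector scheduling on identical machines: a fixed set $M$ of $m$ machines, $d\ge1$ dimensions; jobs $j$ arrive online one by one, each revealing a nonnegative load vector $p_j=\langle p_j(k):k\in[d]\rangle$ (the same on every machine) on arrival, and must be immediately and irrevocably assigned to a machine. An assignment $f$ yields loads $\Lambda_i(k)=\sum_{j:f(j)=i}p_j(k)$ and vectors $\Lambda(k)=(\Lambda_i(k))_{i\in M}$. For $r\ge1$, the $L_r$ objective in dimension $k$ is $\|\Lambda(k)\|_r=\left(\sum_{i\in M}\Lambda_i(k)^r\right)^{1/r}$. For each $r$, loads are normalized so that the optimal offline value of the $L_r$ norm is at most $1$ in each dimension. An online algorithm is $\alpha_r$-competitive for the $L_r$ norm if its assignment satisfies $\|\Lambda(k)\|_r\le\alpha_r$ for every dimension $k$; in VSALL-I the algorithm's single assignment must achieve these guarantees for all $r\ge1$ simultaneously. *)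

(* Defs.v *)
From HB Require Import structures.
From mathcomp Require Import all_boot all_order all_algebra.
From mathcomp Require Import all_classical all_reals all_analysis.

Set Implicit Arguments.
Unset Strict Implicit.
Unset Printing Implicit Defensive.

Import Order.TTheory GRing.Theory Num.Theory.
Local Open Scope ring_scope.

(* A job is its load vector in 'rV[R]_d, identical on every machine; an input
   is the sequence of jobs in arrival order. An assignment sends the index of
   a job to a machine; its values at indices >= size p are irrelevant. *)
Definition machine_load (R : realType) (m d : nat) (p : seq 'rV[R]_d)
    (f : nat -> 'I_m) (i : 'I_m) (k : 'I_d) : R :=
  \sum_(j < size p | f j == i) p`_j 0 k.

Definition Lr_norm (R : realType) (m : nat) (r : R) (x : 'I_m -> R) : R :=
  (\sum_(i < m) x i `^ r) `^ r^-1.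

Definition load_norm (R : realType) (m d : nat) (r : R) (p : seq 'rV[R]_d)
    (f : nat -> 'I_m) (k : 'I_d) : R :=
  Lr_norm r (fun i => machine_load p f i k).

Definition nonneg_loads (R : realType) (d : nat) (p : seq 'rV[R]_d) : Prop :=
  forall v, v \in p -> forall k : 'I_d, 0 <= v 0 k.

(* The offline optimum for the L_r norm is at most 1 in each dimension: a
   single offline assignment achieves this for all dimensions together. *)
Definition opt_le1 (R : realType) (m d : nat) (r : R)
    (p : seq 'rV[R]_d) : Prop :=
  exists f : nat -> 'I_m, forall k : 'I_d, load_norm r p f k <= 1.

(* A deterministic online rule maps the jobs seen so far (the last one being
   the job to assign) to a machine. Earlier decisions are determined by
   earlier prefixes, so they need not be passed again. *)
Definition online_rule (R : realType) (m d : nat) : Type :=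
  seq 'rV[R]_d -> 'I_m.

Definition online_assignment (R : realType) (m d : nat)
    (A : online_rule R m d) (p : seq 'rV[R]_d) : nat -> 'I_m :=
  fun j => A (take j.+1 p).

(* Algorithms are given for all numbers of machines and dimensions; to have
   at least one machine, the number of machines is written m.+1. *)

(* Single-norm problem: the rule sees loads already normalized for L_r. *)
Definition vs_algorithm (R : realType) : Type :=
  forall m d : nat, online_rule R m.+1 d.

Definition vs_competitive (R : realType) (A : vs_algorithm R) (r : R)
    (d : nat) (alpha : R) : Prop :=
  forall (m : nat) (p : seq 'rV[R]_d),
    nonneg_loads p -> opt_le1 m.+1 r p ->
    forall k : 'I_d, load_norm r p (online_assignment (A m d) p) k <= alpha.

(* All-norms problem: the normalization differs from one r to another, so it
   is carried by factors T r k with p k / T r k the k-th load normalized for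
   L_r. Seeing the loads normalized for every r amounts to seeing the raw
   loads and knowing T, hence T is an argument of the algorithm. A common
   scaling for all r would be wrong: opt_le1 at r = 1 bounds the total volume
   by 1, so that every assignment has all its L_r norms at most 1. *)
Definition normalize (R : realType) (d : nat) (s : 'I_d -> R)
    (p : seq 'rV[R]_d) : seq 'rV[R]_d :=
  [seq \row_k (v 0 k / s k) | v : 'rV[R]_d <- p].

Definition vsall_algorithm (R : realType) : Type :=
  forall m d : nat, (R -> 'I_d -> R) -> online_rule R m.+1 d.

Definition vsall_competitive (R : realType) (A : vsall_algorithm R)
    (d : nat) (alpha : R -> R) : Prop :=
  forall (m : nat) (T : R -> 'I_d -> R) (p : seq 'rV[R]_d),
    (forall r k, 1 <= r -> 0 < T r k) ->
    nonneg_loads p ->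
    (forall r, 1 <= r -> opt_le1 m.+1 r (normalize (T r) p)) ->
    forall (r : R) (k : 'I_d), 1 <= r ->
      load_norm r (normalize (T r) p) (online_assignment (A m d T) p) k
        <= alpha r.

Definition vs_rate (R : realType) (r : R) (d : nat) : R :=
  (ln d%:R / ln (ln d%:R)) `^ ((r - 1) / r).

(* Main.v *)
(* Upper bound. Divide the loads of dimension k by the largest mean machine load
   mu_k that the normalizations permit, so that the total relative load is at
   most the number M of machines. For every scale 2^a, keep the load that a
   machine gets from jobs of relative size at most 2^a below O(log d/loglog d) 2^a.
   A potential shows that this is possible: its average over any M/2 machines
   does not increase, and a machine above one of its caps costs a factor
   polynomial in d, so at least half of the machines always remain usable.
   On a machine of load Y, jobs smaller than Y/O(log d/loglog d) then make up at
   most half of Y, so that Y^r is at most O(log d/loglog d)^(r-1) times the mean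
   term Y plus the sum of the q_j^r, and both terms are charged to the optimum.

   Lower bound. The adversary presents the vertices of a graph; machines are
   colours for the algorithm, and the adversary keeps a proper colouring with
   as many colours. A vertex comes with two colours {a, b} and is adjacent to
   the earlier vertices of other colours; the adversary fixes its colour after
   the algorithm has chosen a machine. Every machine carries a clique of
   vertices of distinct colours. If the same number of machines own a as b, and
   none owns both, then the adversary can force the sum over the colours of the
   squared numbers of owners to grow, so that a monochromatic clique of size s
   appears after a number of rounds polynomial in s. With one dimension for
   each of the s^O(s) candidate cliques of s vertices, the optimum has load
   norm s^(1/r) and the algorithm s. *)

Require Import Defs.
From HB Require Import structures.
From mathcomp Require Import all_boot zify.

Set Implicit Arguments.
Unset Strict Implicit.
Unset Printing Implicit Defensive.

(** * A clique game *)

Lemma card_bigcup_leq (I T : finType) (P : {pred I}) (F : I -> {set T}) (s : nat) :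
  (forall i, #|F i| <= s) -> #|\bigcup_(i in P) F i| <= #|P| * s.
Proof.
move=> Fs; rewrite -sum_nat_const.
elim/big_rec2: _ => [|i n A _ An]; first by rewrite cards0.
by rewrite (leq_trans (leq_card_setU _ _)) // leq_add.
Qed.

(** Otherwise any two colours with equally many owners share an owner. By Markov at least half of
    the colours have at most [2 * s] owners; those with exactly [x] owners all meet the owners of
    one of them, so there are too few colours. *)
Lemma disjoint_equicardinal_pair (I C : finType) (H : I -> {set C}) (s : nat) :
    #|I| <= #|C| -> 2 * ((2 * s).+1 * (2 * s * s + 2)) <= #|C| ->
    (forall i, #|H i| <= s) ->
  exists a b, [/\ a != b, #|[set i | a \in H i]| = #|[set i | b \in H i]|
    & forall i, a \in H i -> b \notin H i].
Proof.
move=> leIC leC Hs; pose B a := [set i | a \in H i].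
have [/existsP[a /existsP[b /and3P[ab /eqP eqB /forallP dis]]]|nex] :=
  boolP [exists a, exists b, [&& a != b, #|B a| == #|B b|
    & [forall i, (a \in H i) ==> (b \notin H i)]]].
  by exists a, b; split => // i; apply/implyP.
exfalso; move: nex; rewrite negb_exists => /forallP nex.
have conflict a b : a != b -> #|B a| = #|B b| ->
    exists2 i, a \in H i & b \in H i.
  move=> ab eqB; move: (nex a); rewrite negb_exists => /forallP/(_ b).
  rewrite ab eqB eqxx /= negb_forall => /existsP[i].
  by rewrite negb_imply negbK => /andP[ai bi]; exists i.
have sumB : \sum_a #|B a| <= #|C| * s.
  have -> : \sum_a #|B a| = \sum_i #|H i|.
    under eq_bigr => a _ do rewrite -sum1dep_card.
    rewrite (exchange_big_dep xpredT) //=.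
    by apply: eq_bigr => i _; rewrite sum1_card.
  rewrite (leq_trans (n := #|I| * s)) ?leq_mul2r ?leIC ?orbT //.
  by rewrite -sum_nat_const leq_sum.
pose D := [set a | #|B a| <= 2 * s].
have cardD : #|C| <= 2 * #|D|.
  have /leq_trans/(_ sumB) : (2 * s).+1 * #|~: D| <= \sum_a #|B a|.
    rewrite mulnC -sum_nat_const [leqRHS](bigID (mem (~: D))) /=.
    rewrite (leq_trans _ (leq_addr _ _)) // leq_sum // => a.
    by rewrite !inE -ltnNge.
  have := cardsC D; move: #|D| #|~: D| => x y; move: #|C| => z; nia.
(* The successor accounts for [a] itself, which lies in no [H i] when [x = 0]. *)
have cardE x : x <= 2 * s -> #|[set a | #|B a| == x]| <= (2 * s * s).+1.
  move=> xs; have [->|[a]] := set_0Vmem [set a | #|B a| == x].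
    by rewrite cards0.
  rewrite inE => /eqP Ba.
  have /subset_leq_card/leq_trans -> // :
      [set a | #|B a| == x] \subset a |: \bigcup_(i in B a) H i.
    apply/subsetP => b; rewrite !inE => /eqP Bb.
    have [//|ba] := eqVneq b a; apply/bigcupP.
    have [||i ai bi] := conflict a b; rewrite 1?eq_sym ?Ba ?Bb //.
    by exists i; rewrite // inE.
  rewrite cardsU1 -add1n leq_add ?leq_b1 //.
  by rewrite (leq_trans (card_bigcup_leq _ Hs)) // Ba leq_mul2r xs orbT.
have : #|D| <= (2 * s).+1 * (2 * s * s).+1.
  have <- : \sum_(x < (2 * s).+1) (2 * s * s).+1 = (2 * s).+1 * (2 * s * s).+1.
    by rewrite sum_nat_const card_ord.
  rewrite -sum1_card (partition_big (fun a => inord #|B a| : 'I_(2 * s).+1)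
    xpredT) //=; apply: leq_sum => x _.
  rewrite sum1dep_card (leq_trans _ (cardE x _)) -1?ltnS //.
  apply/subset_leq_card/subsetP => a; rewrite !inE => /andP[Da /eqP <-].
  by rewrite inordK.
by move: cardD leC; move: #|C| #|D| => x y; nia.
Qed.

Section OnlineCliqueGame.
Variables (m : nat) (alg : seq ({set 'I_m.+1} * 'I_m.+1) -> {set 'I_m.+1} -> 'I_m.+1).
Implicit Types (h : seq ({set 'I_m.+1} * 'I_m.+1)) (a b c e i : 'I_m.+1).
Implicit Types (K : {set 'I_m.+1}) (pos : 'I_m.+1 -> nat).

(* A vertex is a set of allowed colours together with the colour that the
   adversary picks in it. An earlier vertex [u] is adjacent to a later vertex
   [v] iff the colour of [u] is not allowed for [v]. *)
Definition vertex h v := nth (set0, ord0) h v.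

(* [K] is the set of colours of a clique put on machine [i] by [alg], and
   [pos a] is its vertex of colour [a]. *)
Definition mono_clique h i K pos :=
  forall a, a \in K ->
    [/\ pos a < size h, (vertex h (pos a)).2 = a,
        alg (take (pos a) h) (vertex h (pos a)).1 = i
      & forall b, b \in K -> pos a < pos b -> a \notin (vertex h (pos b)).1].

Definition proper_history h :=
  all (fun x : {set 'I_m.+1} * 'I_m.+1 => x.2 \in x.1) h.

Definition owners (H : 'I_m.+1 -> {set 'I_m.+1}) a := [set i | a \in H i].

Lemma mono_clique_rcons h x i K pos :
  mono_clique h i K pos -> mono_clique (rcons h x) i K pos.
Proof.
move=> cl a aK; have [pa ca ia adj] := cl a aK.
have vE b : b \in K -> vertex (rcons h x) (pos b) = vertex h (pos b).
  by case/cl => pb _ _ _; rewrite /vertex nth_rcons pb.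
rewrite size_rcons ltnW ?ltnS ?vE // -cats1 takel_cat 1?ltnW //; split => // b bK.
by rewrite cats1 vE //; apply: adj.
Qed.

(* The member of colour [e], the only one not adjacent to the new vertex, is
   dropped from the clique. *)
Lemma mono_clique_extend h c e i K pos :
    c \notin K -> alg h [set c; e] = i ->
    mono_clique h i K pos ->
  mono_clique (rcons h ([set c; e], c)) i (c |: K :\ e)
    (fun a => if a == c then size h else pos a).
Proof.
move=> cK ai cl a; rewrite !inE => aK'.
have vE b : b != c -> (b == c) || (b != e) && (b \in K) ->
    [/\ pos b < size h, b != e, b \in K & vertex (rcons h ([set c; e], c)) (pos b) = vertex h (pos b)].
  move=> /negPf -> /andP[be bK]; have [pb _ _ _] := cl b bK.
  by split => //; rewrite /vertex nth_rcons pb.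
have vc : vertex (rcons h ([set c; e], c)) (size h) = ([set c; e], c).
  by rewrite /vertex nth_rcons ltnn eqxx.
have [->|ac] := eqVneq a c.
  rewrite size_rcons vc -cats1 take_size_cat //; split=> // b; rewrite !inE => bK'.
  have [|bc] := eqVneq b c; first by rewrite ltnn.
  by have [pb _ _ _] := vE b bc bK'; rewrite ltnNge ltnW.
have [pa ae aK va] := vE a ac aK'; have [_ ca ia adj] := cl a aK.
rewrite size_rcons ltnW ?ltnS ?va // -cats1 takel_cat 1?ltnW //.
split => // b; rewrite !inE => bK'; have [bc|bc] := eqVneq b c.
  by rewrite cats1 vc !inE (negPf ac) (negPf ae).
by have [pb be bK vb] := vE b bc bK'; rewrite cats1 vb; apply: adj.
Qed.

(** If [c] and [e] have [x] owners each, [c] ends with [x + 1] and [e] loses at most one, and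
    [(x + 1)^2 + (x - 1)^2 > 2 x^2]. *)
Lemma sum_owners_sqr_lt (H H' : 'I_m.+1 -> {set 'I_m.+1}) c e i :
    c != e -> #|owners H c| = #|owners H e| -> c \notin H i ->
    (forall j, H' j = if j == i then c |: H i :\ e else H j) ->
  \sum_a #|owners H a| ^ 2 < \sum_a #|owners H' a| ^ 2.
Proof.
move=> ce eqB ci H'E.
rewrite (bigD1 c) // (bigD1 e) 1?eq_sym //= addnA.
rewrite [ltnRHS](bigD1 c) // (bigD1 e) 1?[e == c]eq_sym //= addnA.
have -> : \sum_(a | (a != c) && (a != e)) #|owners H' a| ^ 2
        = \sum_(a | (a != c) && (a != e)) #|owners H a| ^ 2.
  apply: eq_bigr => a /andP[ac ae].
  congr (#|pred_of_set _| ^ 2); apply/setP => j.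
  by rewrite !inE H'E; case: eqP => // ->; rewrite !inE (negPf ac) ae.
rewrite ltn_add2r.
have -> : owners H' c = i |: owners H c.
  by apply/setP => j; rewrite !inE H'E; case: eqP => // ->; rewrite !inE eqxx.
have -> : owners H' e = owners H e :\ i.
  apply/setP => j; rewrite !inE H'E; case: eqP => // ->.
  by rewrite !inE eqxx eq_sym (negPf ce).
rewrite cardsU1 inE ci eqB /= (cardsD1 i (owners H e)).
by case: (i \in _); move: #|_ :\ _| => x; nia.
Qed.

Lemma clique_game_rounds (s n : nat) :
    2 * ((2 * s).+1 * (2 * s * s + 2)) <= m.+1 ->
  exists h (H : 'I_m.+1 -> {set 'I_m.+1}) (pos : 'I_m.+1 -> 'I_m.+1 -> nat),
    [/\ size h <= n, proper_history h,
        forall i, mono_clique h i (H i) (pos i)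
      & (exists i, s <= #|H i|) \/ n <= \sum_a #|owners H a| ^ 2].
Proof.
move=> sm; elim: n => [|n [h [H [pos [hn hv cl sH]]]]].
  exists [::], (fun=> set0), (fun _ _ => 0); split=> //; last by right.
  by move=> i a; rewrite inE.
have [/existsP[i si]|nsH] := boolP [exists i, s <= #|H i|].
  by exists h, H, pos; split=> //; [exact: ltnW | left; exists i].
case: sH => [[i si]|nH]; first by move/existsP: nsH; case; exists i.
have Hs i : #|H i| <= s.
  by move: nsH; rewrite negb_exists => /forallP/(_ i); rewrite -ltnNge => /ltnW.
have [||a [b [ab eqB dis]]] := @disjoint_equicardinal_pair _ _ H s _ _ Hs;
  rewrite ?card_ord //.
pose i := alg h [set a; b].
(* The new vertex gets the colour [c] that the chosen machine lacks; no machine owns both [a] and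
   [b]. *)
have [c [e [ce eqce ci setE]]] : exists c e, [/\ c != e,
    #|owners H c| = #|owners H e|, c \notin H i & [set c; e] = [set a; b]].
  have [/dis bi|ai] := boolP (a \in H i); last by exists a, b.
  by exists b, a; split; rewrite // 1?eq_sym // setUC.
pose H' j := if j == i then c |: H i :\ e else H j.
exists (rcons h ([set c; e], c)), H',
  (fun j x => if (j == i) && (x == c) then size h else pos j x).
split.
- by rewrite size_rcons.
- by rewrite /proper_history all_rcons [all _ _]hv andbT !inE eqxx.
- move=> j; rewrite /H'; case: eqVneq => [->|_] /=.
    by apply: mono_clique_extend; rewrite // setE.
  exact: mono_clique_rcons.
- by right; exact: leq_ltn_trans nH (sum_owners_sqr_lt ce eqce ci (fun=> erefl)).
Qed.

(** The sum of squared owner counts is at most [m.+1 ^ 3], so one more round leaves only a large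
    clique. *)
Lemma clique_game (s : nat) :
    2 * ((2 * s).+1 * (2 * s * s + 2)) <= m.+1 ->
  exists h i K pos, [/\ size h <= (m.+1 ^ 3).+1, proper_history h,
    mono_clique h i K pos & s <= #|K|].
Proof.
move=> /(clique_game_rounds (m.+1 ^ 3).+1)[h [H [pos [hn hv cl]]]].
case=> [[i si]|]; first by exists h, i, (H i), (pos i).
rewrite ltnNge (leq_trans (n := \sum_(a < m.+1) m.+1 ^ 2)) //.
  apply: leq_sum => a _.
  by rewrite leq_sqr -[leqRHS]card_ord max_card.
by rewrite sum_nat_const card_ord -expnS.
Qed.

End OnlineCliqueGame.

From mathcomp Require Import all_order all_algebra.
From mathcomp Require Import all_classical all_reals all_analysis.
From mathcomp Require Import ring lra.

Import Order.TTheory GRing.Theory Num.Theory.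
Local Open Scope ring_scope.

(** * From cliques to load vectors *)

Lemma Lr_norm_ge (R : realType) (m : nat) (r : R) (x : 'I_m -> R) (i : 'I_m) :
  0 < r -> (forall j, 0 <= x j) -> x i <= Lr_norm r x.
Proof.
move=> r0 x0; rewrite -[leLHS](powRr1 (x0 i)) -(divff (lt0r_neq0 r0)) powRrM.
have sum0 (P : pred 'I_m) : 0 <= \sum_(j | P j) x j `^ r.
  by apply: sumr_ge0 => j _; apply: powR_ge0.
apply: ge0_ler_powR; rewrite ?nnegrE ?powR_ge0 ?invr_ge0 ?(ltW r0) //.
by rewrite (bigD1 i) //= lerDl.
Qed.

Lemma Lr_norm_le1 (R : realType) (m : nat) (r : R) (x : 'I_m -> R) :
  0 < r -> (Lr_norm r x <= 1) = (\sum_i x i `^ r <= 1).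
Proof.
move=> r0; have s0 : 0 <= \sum_i x i `^ r.
  by apply: sumr_ge0 => i _; apply: powR_ge0.
have one y : (1 : R) `^ y = 1 by rewrite powR1.
apply/idP/idP => [n1|s1].
  rewrite -[leLHS](powRr1 s0) -[X in _ `^ X <= _](mulVf (lt0r_neq0 r0)) powRrM.
  rewrite -[leRHS](one r).
  by apply: ge0_ler_powR; rewrite ?nnegrE ?powR_ge0 ?(ltW r0).
rewrite -[leRHS](one r^-1).
by apply: ge0_ler_powR; rewrite ?nnegrE ?invr_ge0 ?(ltW r0).
Qed.

(** Applied to the adversary's colouring, where at most one job on each machine loads a given
    dimension. *)
Lemma powR_sum_subsingleton (R : realType) (I : finType) (P : pred I)
    (F : I -> R) (r : R) :
    r != 0 ->
    (forall i j, P i -> P j -> F i != 0 -> F j != 0 -> i = j) ->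
  (\sum_(i | P i) F i) `^ r = \sum_(i | P i) F i `^ r.
Proof.
move=> r0 F1; have [/existsP[i /andP[Pi Fi]]|nF] :=
    boolP [exists i, P i && (F i != 0)].
  rewrite (bigD1 i) //= [in RHS](bigD1 i) //=.
  have F0 j : P j && (j != i) -> F j = 0.
    by case/andP=> Pj; apply: contraNeq => Fj; apply/eqP/F1.
  rewrite big1 // addr0 [X in _ = _ + X]big1 ?addr0 // => j /F0 ->.
  by rewrite powR0.
have F0 i : P i -> F i = 0.
  move=> Pi; move: nF; rewrite negb_exists => /forallP/(_ i).
  by rewrite Pi negbK => /eqP.
rewrite big1 // powR0 // big1 // => i /F0 ->.
by rewrite powR0.
Qed.

Section CliqueJobs.
Variables (R : realType) (m d s n : nat).
Variables (w : R) (g_ : 'I_d -> {ffun 'I_s -> 'I_n}).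
Implicit Types (h : seq ({set 'I_m.+1} * 'I_m.+1)) (g : {ffun 'I_s -> 'I_n}).

(* A dimension stands for a list [g] of candidate members of a clique; no job
   loads it any more once the candidates seen so far fail to form a clique. *)
Definition active h g v : bool :=
  [exists x, g x == v :> nat] &&
  [forall x, forall y, (g x < g y <= v)%N ==>
     ((vertex h (g x)).2 \notin (vertex h (g y)).1)].

Definition clique_job h v : 'rV[R]_d :=
  \row_k (if active h (g_ k) v then w else 0).

Definition clique_jobs h := mkseq (clique_job h) (size h).

(** Only colours of vertices strictly before [v] are read, so a job can be presented before its
    vertex is coloured. *)
Lemma active_eq h h' g v :
    (forall u, (u < v)%N -> vertex h u = vertex h' u) ->
    (vertex h v).1 = (vertex h' v).1 ->
  active h g v = active h' g v.
Proof.
move=> hu hv; congr (_ && _).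
apply/eq_forallb => x; apply/eq_forallb => y.
case: ltnP => //= xy; case: ltngtP => //= yv.
  by rewrite !hu // (ltn_trans xy).
by rewrite yv hv hu // -yv.
Qed.

Lemma clique_job_eq h h' v :
    (forall u, (u < v)%N -> vertex h u = vertex h' u) ->
    (vertex h v).1 = (vertex h' v).1 ->
  clique_job h v = clique_job h' v.
Proof. by move=> hu hv; apply/rowP => k; rewrite !mxE (@active_eq h h'). Qed.

(* The load vector of a new vertex does not depend on the colour that the
   adversary will give it, hence the arbitrary [ord0]. *)
Definition clique_alg (A : online_rule R m.+1 d) h (S : {set 'I_m.+1}) :=
  A (rcons (clique_jobs h) (clique_job (rcons h (S, ord0)) (size h))).

Lemma online_assignment_clique_jobs (A : online_rule R m.+1 d) h v :
    (v < size h)%N ->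
  online_assignment A (clique_jobs h) v =
  clique_alg A (take v h) (vertex h v).1.
Proof.
move=> vh; rewrite /online_assignment /clique_alg /clique_jobs.
have stake : size (take v h) = v by rewrite size_takel // ltnW.
have vtake u : (u < v)%N -> vertex (take v h) u = vertex h u.
  by move=> uv; rewrite /vertex nth_take.
have iotaS : iota 0 v.+1 = rcons (iota 0 v) v by rewrite -addn1 iotaD cats1.
congr A; rewrite -map_take take_iota (minn_idPl vh) iotaS map_rcons stake.
congr rcons.
  apply/eq_in_map => u; rewrite mem_iota add0n => /= uv.
  apply: clique_job_eq => [u' u'u|]; rewrite vtake //.
  exact: ltn_trans uv.
apply: clique_job_eq => [u uv|].
  by rewrite -vtake // /vertex nth_rcons stake uv.
by rewrite {2}/vertex nth_rcons stake ltnn eqxx.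
Qed.

Lemma card_active h g N : (#|[set v : 'I_N | active h g v]| <= s)%N.
Proof.
rewrite cardE -(size_map val) -[leqRHS]card_ord -(size_image (fun x => g x : nat)).
apply: uniq_leq_size; first by rewrite (map_inj_uniq val_inj) enum_uniq.
move=> _ /mapP[v + ->]; rewrite mem_enum inE => /andP[/existsP[x /eqP gx] _].
by apply/fintype.imageP; exists x.
Qed.

(** Activity at [v] forbids the colour of the candidate [u] for [v], whereas the colour of [v] is
    allowed. *)
Lemma active_color_inj h g (u v : nat) :
    proper_history h -> (v < size h)%N -> (u < v)%N ->
    active h g u -> active h g v -> (vertex h u).2 != (vertex h v).2.
Proof.
move=> hh vh uv /andP[/existsP[x /eqP xu] _] /andP[/existsP[y /eqP yv]].
move=> /forallP/(_ x)/forallP/(_ y); rewrite xu yv uv leqnn /=.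
by apply: contraNneq => ->; apply: (allP hh); apply: mem_nth.
Qed.

Lemma clique_jobs_nonneg h : 0 <= w -> nonneg_loads (clique_jobs h).
Proof. by move=> w0 _ /mapP[v _ ->] k; rewrite mxE; case: ifP. Qed.

Lemma nth_clique_jobs h v k : (v < size h)%N ->
  (clique_jobs h)`_v 0 k = if active h (g_ k) v then w else 0.
Proof. by move=> vh; rewrite nth_mkseq // mxE. Qed.

(** The offline assignment is the adversary's colouring: the active vertices of a dimension, at most
    [s], go to distinct machines. *)
Lemma opt_le1_clique_jobs (r : R) h :
    0 < r -> 0 <= w -> w `^ r *+ s <= 1 -> proper_history h ->
  opt_le1 m.+1 r (clique_jobs h).
Proof.
move=> r0 w0 ws hh; exists (fun v => (vertex h v).2) => k.
rewrite /load_norm Lr_norm_le1 //.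
have wlt (v : 'I_(size (clique_jobs h))) : (v < size h)%N.
  by rewrite -[ltnRHS](size_mkseq (clique_job h)).
under eq_bigr => i _.
  rewrite /machine_load powR_sum_subsingleton ?gt_eqF //; first over.
  move=> u v /eqP cu /eqP cv; rewrite !nth_clique_jobs //.
  case: ifP => [au _|]; last by rewrite eqxx.
  case: ifP => [av _|]; last by rewrite eqxx.
  apply/val_inj; case: (ltngtP u v) => // uv.
    by have := active_color_inj hh (wlt v) uv au av; rewrite cu cv eqxx.
  by have := active_color_inj hh (wlt u) uv av au; rewrite cu cv eqxx.
have -> : \sum_i \sum_(v < size (clique_jobs h) | (vertex h v).2 == i)
      (clique_jobs h)`_v 0 k `^ r
    = \sum_(v < size (clique_jobs h)) (clique_jobs h)`_v 0 k `^ r.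
  by rewrite [RHS](partition_big (fun v : 'I__ => (vertex h v).2) xpredT).
under eq_bigr do rewrite nth_clique_jobs //.
rewrite (bigID (fun v => active h (g_ k) (val v))) /=.
rewrite [X in _ + X]big1 ?addr0 => [|v /negPf ->]; last by rewrite powR0 // gt_eqF.
under eq_bigr => v -> do [].
apply: le_trans ws; rewrite sumr_const.
rewrite ler_wpMn2l ?powR_ge0 //; apply: leq_trans (card_active h (g_ k) _).
by apply/eq_leq/eq_card => v; rewrite inE.
Qed.

End CliqueJobs.

Lemma vs_competitive_ge (R : realType) (m d s : nat) (r : R)
    (A : vs_algorithm R) (alpha : R) :
    1 <= r -> (0 < s)%N -> (2 * ((2 * s).+1 * (2 * s * s + 2)) <= m.+1)%N ->
    ((m.+1 ^ 3).+1 ^ s <= d)%N -> vs_competitive A r d alpha ->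
  s%:R `^ ((r - 1) / r) <= alpha.
Proof.
move=> r1 s0 sm nd Aalpha; set n := (m.+1 ^ 3).+1 in nd *.
have r0 : 0 < r by apply: lt_le_trans r1.
(* Chosen so that [s * w^r = 1], while [s] jobs on one machine load it by
   [s * w = s^((r - 1) / r)]. *)
pose w : R := s%:R `^ (- r^-1).
pose g0 : {ffun 'I_s -> 'I_n} := [ffun=> ord0].
(* As [n ^ s <= d], every list of [s] vertices has a dimension; surplus dimensions repeat [g0]. *)
pose g_ (k : 'I_d) := nth g0 (enum {ffun 'I_s -> 'I_n}) k.
have g_surj g : exists k, g_ k = g.
  have gd : (index g (enum {ffun 'I_s -> 'I_n}) < d)%N.
    apply: leq_trans nd; rewrite -[X in (X ^ _)%N]card_ord -[X in (_ ^ X)%N]card_ord.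
    by rewrite -card_ffun cardE index_mem mem_enum.
  by exists (Ordinal gd); rewrite /g_ /= nth_index // mem_enum.
have [h [i [K [pos [hn hh cl sK]]]]] :=
  clique_game (clique_alg w g_ (A m d)) sm.
have w0 : 0 <= w := powR_ge0 _ _.
have ws : w `^ r *+ s <= 1.
  rewrite -powRrM mulNr mulVf ?gt_eqF // powR_inv1 // -mulr_natr mulVf //.
  by rewrite pnatr_eq0 -lt0n.
pose a x := nth ord0 (enum K) x.
have aK x : (x < s)%N -> a x \in K.
  by move=> xs; rewrite -mem_enum mem_nth // -cardE (leq_trans xs).
have posn x : (x < s)%N -> (pos (a x) < n)%N.
  by move=> /aK/cl[/leq_trans + _ _ _]; apply.
(* The dimension whose candidates are [s] vertices of the clique found; each of them is active in
   it. *)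
have [k gk] := g_surj [ffun x : 'I_s => inord (pos (a x))].
have gE x : g_ k x = pos (a x) :> nat.
  by rewrite gk ffunE inordK // posn.
have := Aalpha m _ (clique_jobs_nonneg (g_ := g_) (h := h) w0)
  (opt_le1_clique_jobs g_ r0 w0 ws hh) k.
apply: le_trans.
set p := clique_jobs w g_ h; set f := online_assignment _ _.
have load0 j : 0 <= machine_load p f j k.
  apply: sumr_ge0 => v _; apply: (clique_jobs_nonneg (g_ := g_) (h := h) w0).
  by rewrite mem_nth.
apply: le_trans (Lr_norm_ge i r0 load0).
pose V := [set v : 'I_(size p) | (f v == i) && active h (g_ k) v].
have sp : size p = size h by rewrite size_mkseq.
have sV : (s <= #|V|)%N.
  rewrite -[leqLHS](size_iota 0) -(size_map (pos \o a)).
  rewrite cardE -(size_map val); apply: uniq_leq_size.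
    rewrite map_inj_in_uniq ?iota_uniq // => x y.
    rewrite !mem_iota /= !add0n => xs ys /= pxy.
    have [_ cx _ _] := cl _ (aK x xs); have [_ cy _ _] := cl _ (aK y ys).
    have axy : a x = a y by rewrite -cx -cy pxy.
    apply/eqP; rewrite -(nth_uniq ord0 _ _ (enum_uniq (mem K))) -?cardE.
    - exact/eqP.
    - exact: leq_trans sK.
    - exact: leq_trans sK.
  move=> _ /mapP[x + ->]; rewrite mem_iota add0n => /= xs.
  have [px cx ix _] := cl _ (aK x xs).
  have px' : (pos (a x) < size p)%N by rewrite sp.
  apply/mapP; exists (Ordinal px') => //; rewrite mem_enum inE.
  rewrite /f online_assignment_clique_jobs //= ix eqxx /=; apply/andP; split.
    by apply/existsP; exists (Ordinal xs); rewrite gE.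
  apply/forallP => y; apply/forallP => z; apply/implyP; rewrite !gE => /andP[yz _].
  have [_ -> _ ->] // := cl _ (aK y (ltn_ord y)).
  exact: aK.
rewrite /machine_load (bigID (fun v => v \in V)) /=.
rewrite -[leLHS]addr0 lerD //; last first.
  apply: sumr_ge0 => v _; apply: (clique_jobs_nonneg (g_ := g_) (h := h) w0).
  by rewrite mem_nth.
rewrite (eq_bigl (fun v => v \in V)) => [|v]; last first.
  by rewrite inE; case: (f v == i).
rewrite (eq_bigr (fun=> w)) => [|v]; last first.
  by rewrite inE nth_clique_jobs -?sp // => /andP[_ ->].
rewrite sumr_const; apply: le_trans (ler_wpMn2l w0 sV).
rewrite mulrBl divff ?gt_eqF // mul1r powRD; last by rewrite pnatr_eq0 -lt0n s0 implybT.
by rewrite powRr1 // mulr_natl.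
Qed.

(** * Consequences of a bounded optimum *)

(** The bound [ln x <= x - 1] at [b / c] and [1 / c], with [c = 1 + q (b - 1)]; the right-hand sides
    cancel under the weights [q] and [1 - q]. *)
Lemma powR_bernoulli (R : realType) (b q : R) :
  0 <= b -> 0 <= q <= 1 -> b `^ q <= 1 + q * (b - 1).
Proof.
rewrite le_eqVlt => /predU1P[<-|b0] /andP[q0 q1].
  have [->|qn0] := eqVneq q 0; first by rewrite powRr0 mul0r addr0.
  by rewrite powR0 //; lra.
have ln_le (x : R) : 0 < x -> ln x <= x - 1.
  by move=> x0; rewrite -{1}[x](subrK 1) addrC le_ln1Dx //; lra.
set c := 1 + _; have c0 : 0 < c by rewrite /c; nra.
rewrite -ler_ln ?posrE ?powR_gt0 // ln_powR.
have hb : ln b - ln c <= b / c - 1.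
  by rewrite -ln_div ?posrE // ln_le // divr_gt0.
have h1 : - ln c <= c^-1 - 1 by rewrite -lnV ?posrE // ln_le // invr_gt0.
have : q * (b / c - 1) + (1 - q) * (c^-1 - 1) = 0.
  by rewrite /c; field; rewrite -/c gt_eqF.
nra.
Qed.

Lemma capped_sum_powR (R : realType) (T : Type) (s : seq T) (P : pred T)
    (q : T -> R) (r th : R) (N : nat) :
    (forall x, 0 <= q x) -> 1 <= r -> 1 <= th ->
    \sum_(x <- s | P x) q x <= N%:R ->
    (forall a, (a < N)%N ->
       \sum_(x <- s | P x && (q x <= 2 ^+ a)) q x <= th * 2 ^+ a) ->
  (\sum_(x <- s | P x) q x) `^ r <= 2 * (4 * th) `^ (r - 1) *
    (\sum_(x <- s | P x) q x + \sum_(x <- s | P x) q x `^ r).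
Proof.
move=> q0 r1 th1 YN cap; set Y := \sum_(x <- s | P x) q x in YN *.
have r0 : 0 < r by lra.
have Y0 : 0 <= Y by apply: sumr_ge0 => x _.
have sum0 (Q : pred T) : 0 <= \sum_(x <- s | Q x) q x `^ r.
  by apply: sumr_ge0 => x _; apply: powR_ge0.
rewrite -mulr_powRB1 //; have [Yth|thY] := leP Y (4 * th).
  have := sum0 P; have := powR_ge0 (4 * th) (r - 1).
  have : Y `^ (r - 1) <= (4 * th) `^ (r - 1).
    by apply: ge0_ler_powR; rewrite ?nnegrE //; lra.
  move: (Y `^ _) ((4 * th) `^ _) (\sum_(x <- s | P x) _) => y t S yt t0 S0.
  apply: (@le_trans _ _ (Y * t)); first by rewrite ler_wpM2l.
  by have := mulr_ge0 t0 S0; have := mulr_ge0 t0 Y0; nra.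
(* With 2^a <= Y / (2 th) < 2^(a+1), the jobs of size at most 2^a account for
   at most half of Y, and Y <= 4 th q for every other job q. *)
pose z := Y / (2 * th).
have zE : z * (2 * th) = Y by rewrite /z divfK // gt_eqF //; lra.
have z1 : 1 <= z by rewrite /z ler_pdivlMr; lra.
have /truncn_itv/andP[nz zn] : 0 <= z by lra.
set n := Num.truncn z in nz zn.
have n0 : (0 < n)%N by rewrite -ltnS -(ltr_nat R); exact: le_lt_trans z1 zn.
have [a /andP[an na]] : exists a, (2 ^ a <= n < 2 ^ a.+1)%N.
  by exists (trunc_log 2 n); apply: trunc_log_bounds.
have az : (2 : R) ^+ a <= z by apply: le_trans nz; rewrite -natrX ler_nat.
have za : z < 2 ^+ a * 2.
  by apply: lt_le_trans zn _; rewrite -exprSr -natrX ler_nat.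
(* [a < 2^a <= z <= Y <= N], so the caps at [N] scales suffice. *)
have aN : (a < N)%N.
  apply: leq_trans (ltn_expl a (ltnSn 1)) _.
  rewrite -(ler_nat R) natrX; apply: le_trans az (le_trans _ YN).
  by rewrite -zE ler_peMr; lra.
have YE := bigID (fun x => q x <= 2 ^+ a) P q (r := s) (op := +%R).
rewrite -/Y /= in YE; have {cap aN} := cap a aN.
move: YE; set small := \sum_(x <- s | P x && (q x <= 2 ^+ a)) q x.
set big := \sum_(x <- s | P x && ~~ (q x <= 2 ^+ a)) q x => YE small_le.
have thz : th * 2 ^+ a <= th * z by rewrite ler_wpM2l //; lra.
have Ybig : Y <= 2 * big by lra.
apply: (@le_trans _ _ (2 * big * Y `^ (r - 1))).
  by rewrite ler_wpM2r // powR_ge0.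
rewrite -!mulrA ler_pM2l // mulr_suml.
apply: (@le_trans _ _
    (\sum_(x <- s | P x && ~~ (q x <= 2 ^+ a)) (4 * th) `^ (r - 1) * q x `^ r)).
  apply: ler_sum => x /andP[_]; rewrite -ltNge => ax.
  rewrite -[q x `^ r]mulr_powRB1 // mulrCA ler_wpM2l // -powRM //; last lra.
  by apply: ge0_ler_powR; rewrite ?nnegrE ?mulr_ge0 //; nra.
rewrite -mulr_sumr ler_wpM2l ?powR_ge0 // [in leRHS](bigID (fun x => q x <= 2 ^+ a)) /=.
by have := sum0 (fun x => P x && (q x <= 2 ^+ a)); lra.
Qed.

(** The volume is the same for every assignment, so the power mean inequality for the optimal loads
    bounds it. *)
Lemma opt_le1_volume (R : realType) (m d : nat) (r : R) (p : seq 'rV[R]_d) k :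
    1 <= r -> nonneg_loads p -> opt_le1 m.+1 r p ->
  \sum_(v <- p) v 0 k <= m.+1%:R / m.+1%:R `^ r^-1.
Proof.
move=> r1 p0 [f /(_ k)]; have r0 : 0 < r by lra.
rewrite /load_norm Lr_norm_le1 // => sum1.
set M : R := m.+1%:R; have M0 : 0 < M by rewrite ltr0n.
rewrite (big_nth 0) big_mkord (partition_big (fun j : 'I__ => f j) xpredT) //=.
set x := fun i => machine_load p f i k; rewrite -[leLHS]/(\sum_i x i).
have x0 i : 0 <= x i by apply: sumr_ge0 => j _; apply: p0; rewrite mem_nth.
rewrite ler_pdivlMr ?powR_gt0 // mulr_suml.
(* Tangent form of the power mean inequality. *)
have xM i : x i * M `^ r^-1 <= 1 + r^-1 * (M * x i `^ r - 1).
  have -> : x i * M `^ r^-1 = (M * x i `^ r) `^ r^-1.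
    by rewrite powRM ?powR_ge0 ?ltW // -powRrM divff ?gt_eqF // powRr1 // mulrC.
  apply: powR_bernoulli; first by rewrite mulr_ge0 ?powR_ge0 // ltW.
  by rewrite invr_ge0 ltW //= invf_le1.
apply: le_trans (ler_sum _ (fun i _ => xM i)) _.
rewrite big_split /= -mulr_sumr sumrB -mulr_sumr !sumr_const card_ord.
rewrite gerDl pmulr_rle0 ?invr_gt0 // subr_le0.
by rewrite -[leRHS]mulr1 ler_wpM2l // ltW.
Qed.

(** Superadditivity of the [r]-th power on each machine of an optimal assignment. *)
Lemma opt_le1_sum_powR (R : realType) (m d : nat) (r : R) (p : seq 'rV[R]_d) k :
    1 <= r -> nonneg_loads p -> opt_le1 m r p ->
  \sum_(v <- p) v 0 k `^ r <= 1.
Proof.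
move=> r1 p0 [f /(_ k)]; have r0 : 0 < r by lra.
rewrite /load_norm Lr_norm_le1 // => /(le_trans _); apply.
rewrite (big_nth 0) big_mkord (partition_big (fun j : 'I__ => f j) xpredT) //=.
apply: ler_sum => i _; rewrite /machine_load.
have p0' (j : 'I_(size p)) : 0 <= p`_j 0 k by apply: p0; rewrite mem_nth.
set S := \sum_(j < _ | f j == i) _ 0 k.
have S0 : 0 <= S by apply: sumr_ge0.
rewrite -mulr_powRB1 // mulr_suml; apply: ler_sum => j fj.
rewrite -mulr_powRB1 // ler_wpM2l //.
apply: ge0_ler_powR; rewrite ?nnegrE ?subr_ge0 //.
by rewrite /S (bigD1 j) //= lerDl sumr_ge0.
Qed.

(** * The potential rule *)

Section PotentialRule.
Variables (R : realType) (m d : nat) (mu : 'I_d -> R) (L theta : R).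
Implicit Types (st : seq ('rV[R]_d * 'I_m.+1)) (p : seq 'rV[R]_d).
Implicit Types (v : 'rV[R]_d) (i : 'I_m.+1) (k : 'I_d) (a : nat).
Local Notation M := (m.+1%:R : R).

(** The absolute value makes relative loads nonnegative on every input. *)
Definition rel_load v k : R := `|v 0 k| / mu k.

Definition capped_load st i k a : R :=
  \sum_(x <- st | (x.2 == i) && (rel_load x.1 k <= 2 ^+ a)) rel_load x.1 k.

Definition volume st k : R := \sum_(x <- st) rel_load x.1 k.

(** The factor [2 ^- a] keeps the initial sum over scales below 2; the base [2 ^+ a * L] makes up
    for it, so that the weight at the cap is still at least [L^theta]. *)
Definition weight st i k a : R :=
  2 ^- a * (2 ^+ a * L) `^ (capped_load st i k a / 2 ^+ a).

Definition total_weight st k : R :=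
  \sum_(a < m.+1) \sum_(i < m.+1) weight st i k a.

(* The exponential factor compensates the expected growth of the weights when
   the jobs seen so far are assigned to uniformly random machines among at
   least half of them; what is left is a pessimistic estimator. *)
Definition potential st : R :=
  \sum_k expR (- (2 * L / M * volume st k)) * total_weight st k.

Definition below_caps st i :=
  [forall k, forall a : 'I_m.+1, capped_load st i k a <= theta * 2 ^+ a].

(** [run_invariant] shows that the default [ord0] is not reached when the total relative loads are
    at most [M]. *)
Definition choose_machine st v : 'I_m.+1 :=
  odflt ord0
    [pick i | below_caps st i && (potential (rcons st (v, i)) <= potential st)].

Definition run p :=
  foldl (fun st v => rcons st (v, choose_machine st v)) [::] p.

(** Earlier decisions are not part of the input of a rule; [run] replays them. *)
Definition potential_rule : online_rule R m.+1 d :=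
  fun p => (last (0, ord0) (run p)).2.

Lemma run_rcons p v :
  run (rcons p v) = rcons (run p) (v, choose_machine (run p) v).
Proof. by rewrite /run -cats1 foldl_cat. Qed.

Lemma big_run p (F : 'rV[R]_d -> R) :
  \sum_(x <- run p) F x.1 = \sum_(v <- p) F v.
Proof.
elim/last_ind: p => [|p v IHp]; first by rewrite !big_nil.
by rewrite run_rcons -!cats1 !big_cat IHp !big_seq1.
Qed.

Lemma big_run_machine p i (F : 'rV[R]_d -> R) :
  \sum_(j < size p | online_assignment potential_rule p j == i) F p`_j =
  \sum_(x <- run p | x.2 == i) F x.1.
Proof.
elim/last_ind: p => [|p v IHp]; first by rewrite big_ord0 big_nil.
have take_p (j : nat) : (j <= size p)%N -> take j (rcons p v) = take j p.
  by move=> jp; rewrite -cats1 takel_cat.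
rewrite run_rcons -[rcons (run p) _]cats1 big_cat /= -IHp.
rewrite big_mkcond -(big_mkord xpredT (fun j =>
  if online_assignment potential_rule (rcons p v) j == i
  then F (rcons p v)`_j else 0)).
rewrite size_rcons big_nat_recr //= big_mkord -big_mkcond /=.
congr (_ + _).
  apply: eq_big => j; last by rewrite nth_rcons ltn_ord.
  by rewrite /online_assignment take_p.
rewrite big_mkcond big_seq1 /online_assignment take_oversize ?size_rcons //.
by rewrite /potential_rule run_rcons last_rcons nth_rcons ltnn eqxx.
Qed.

Hypothesis mu_ge0 : forall k, 0 <= mu k.
Hypothesis L_ge1 : 1 <= L.

Let L_gt0 : 0 < L := lt_le_trans ltr01 L_ge1.

Lemma rel_load_ge0 v k : 0 <= rel_load v k.
Proof. by rewrite divr_ge0. Qed.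

Lemma weight_ge0 st i k a : 0 <= weight st i k a.
Proof. by rewrite mulr_ge0 ?powR_ge0 // invr_ge0 exprn_ge0. Qed.

Lemma total_weight_ge0 st k : 0 <= total_weight st k.
Proof. by do 2![apply: sumr_ge0 => ? _]; apply: weight_ge0. Qed.

Lemma capped_load_rcons st v j i k a :
  capped_load (rcons st (v, j)) i k a = capped_load st i k a +
    (if (j == i) && (rel_load v k <= 2 ^+ a) then rel_load v k else 0).
Proof. by rewrite /capped_load -cats1 big_cat big_cons big_nil /= addr0. Qed.

Lemma volume_rcons st v j k :
  volume (rcons st (v, j)) k = volume st k + rel_load v k.
Proof. by rewrite /volume -cats1 big_cat big_seq1. Qed.

(** A counted job raises the exponent by [q / 2^a <= 1], so Bernoulli's inequality bounds the growth
    factor by [1 + L q]. *)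
Lemma weight_rcons_le st v j i k a :
  weight (rcons st (v, j)) i k a <=
  weight st i k a * (1 + (j == i)%:R * (L * rel_load v k)).
Proof.
have q0 := rel_load_ge0 v k; set q := rel_load v k in q0 *.
have L0 := L_gt0.
have a0 : (0 : R) < 2 ^+ a by rewrite exprn_gt0.
have w0 := weight_ge0 st i k a.
rewrite /weight capped_load_rcons; case: eqP => _ /=; last first.
  by rewrite addr0 mul0r addr0 mulr1.
rewrite mul1r -/q; case: ifP => [qa|_]; last first.
  by rewrite addr0 ler_peMr // lerDl mulr_ge0 // ltW.
have b0 : 0 < 2 ^+ a * L by rewrite mulr_gt0.
rewrite mulrDl powRD; last by rewrite (gt_eqF b0) implybT.
rewrite mulrA; apply: ler_wpM2l => //.
apply: le_trans (powR_bernoulli (ltW b0) _) _.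
  by rewrite divr_ge0 ?(ltW a0) //= ler_pdivrMr // mul1r.
rewrite lerD2l mulrBr mulr1 lerBlDr mulrA divfK ?gt_eqF // mulrC lerDl.
by rewrite divr_ge0 // ltW.
Qed.

(** Averaging over [G] multiplies the weights by at most [1 + L q / #|G|], and the discount
    [expR (- (2 L q / M))] absorbs this because [M <= 2 #|G|]. *)
Lemma exists_potential_le st v (G : {set 'I_m.+1}) :
    (m.+1 <= 2 * #|G|)%N ->
  exists2 i, i \in G & potential (rcons st (v, i)) <= potential st.
Proof.
move=> mG; have G0 : (0 < #|G|)%N by lia.
have L0 := L_gt0.
have G0R : (0 : R) < #|G|%:R by rewrite ltr0n.
have sumG : \sum_(i in G) potential (rcons st (v, i)) <= #|G|%:R * potential st.
  rewrite exchange_big mulr_sumr /=; apply: ler_sum => k _.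
  under eq_bigr do rewrite volume_rcons.
  rewrite -mulr_sumr mulrDr opprD expRD -mulrA [leRHS]mulrCA.
  apply: ler_wpM2l; first exact: expR_ge0.
  set q := rel_load v k; have q0 : 0 <= q := rel_load_ge0 v k.
  have Lq0 : 0 <= L * q := mulr_ge0 (ltW L0) q0.
  have {}sumG : \sum_(i in G) total_weight (rcons st (v, i)) k <=
      (#|G|%:R + L * q) * total_weight st k.
    rewrite exchange_big mulr_sumr; apply: ler_sum => a _.
    rewrite exchange_big mulr_sumr; apply: ler_sum => i _ /=.
    apply: le_trans (ler_sum _ (fun j _ => weight_rcons_le st v j i k a)) _.
    rewrite -mulr_sumr mulrC ler_wpM2r ?weight_ge0 // big_split /= sumr_const.
    rewrite lerD2l -mulr_suml ler_piMl //.
    rewrite big_mkcond (bigD1 i) //= big1 => [|j /negPf ->]; last by case: ifP.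
    by rewrite eqxx addr0; case: ifP.
  apply: le_trans (ler_wpM2l (expR_ge0 _) sumG) _.
  rewrite mulrA ler_wpM2r ?total_weight_ge0 // expRN mulrC ler_pdivrMr ?expR_gt0 //.
  have := expR_ge1Dx (2 * L / M * q); set e := expR _ => /(ler_wpM2l (ltW G0R)).
  apply: le_trans; rewrite mulrDr mulr1 lerD2l.
  have M0 : 0 < M by rewrite ltr0n.
  have mGR : M <= 2 * #|G|%:R by rewrite -natrM ler_nat.
  have -> : #|G|%:R * (2 * L / M * q) = (2 * #|G|%:R / M) * (L * q).
    by field; rewrite gt_eqF.
  by rewrite ler_peMl // ler_pdivlMr // mul1r.
have [/existsP[i /andP[iG le_i]]|] := boolP
    [exists i, (i \in G) && (potential (rcons st (v, i)) <= potential st)].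
  by exists i.
rewrite negb_exists => /forallP lt_st; move: sumG; rewrite leNgt => /negP[].
rewrite mulr_natl -sumr_const; apply: ltr_sum.
  move: G0; rewrite card_gt0 => /set0Pn[i iG].
  by apply/hasP; exists i; rewrite ?mem_index_enum.
by move=> i iG; have := lt_st i; rewrite iG -ltNge.
Qed.

Lemma potential_nil : potential [::] <= 2 * d%:R * M.
Proof.
have -> : 2 * d%:R * M = \sum_(k < d) 2 * M.
  by rewrite sumr_const card_ord -[RHS]mulr_natl mulrCA mulrA.
apply: ler_sum => k _; rewrite /volume big_nil mulr0 oppr0 expR0 mul1r.
rewrite /total_weight /weight /capped_load.
under eq_bigr do under eq_bigr do rewrite big_nil mul0r powRr0 mulr1.
under eq_bigr do rewrite sumr_const card_ord.
rewrite sumrMnl -[leLHS]mulr_natr ler_pM2r ?ltr0n //.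
have geom l : \sum_(a < l) (2 : R) ^- a = 2 - 2 / 2 ^+ l.
  elim: l => [|l IHl]; first by rewrite big_ord0 expr0 divr1 subrr.
  rewrite big_ord_recr /= IHl exprS; field.
  by rewrite expf_neq0 //.
by rewrite geom gerBl divr_ge0 // exprn_ge0.
Qed.

Hypothesis d_ge2 : (2 <= d)%N.
Hypothesis expL : expR L = d%:R.
Hypothesis theta_ge1 : 1 <= theta.
Hypothesis L_theta : L `^ theta = d%:R ^+ 5.

(** A violated cap gives weight at least [L^theta = d^5], and a volume of at most [M] leaves a
    discount of at least [expR (- 2 L) = d^-2]. *)
Lemma potential_bad st (B : {set 'I_m.+1}) :
    (forall k, volume st k <= M) -> (forall i, i \in B -> ~~ below_caps st i) ->
  #|B|%:R * d%:R ^+ 3 <= potential st.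
Proof.
move=> volM badB; have L0 := L_gt0.
have d0 : (0 : R) < d%:R by rewrite ltr0n ltnW.
have M0 : 0 < M by rewrite ltr0n.
have discount k : (d%:R ^+ 2)^-1 <= expR (- (2 * L / M * volume st k)).
  rewrite -expL -expRM_natl -expRN ler_expR lerN2 mulrAC ler_pdivrMr //.
  by rewrite ler_wpM2l ?mulr_ge0 // ltW.
have weightB i : i \in B -> (d%:R ^+ 5 <= \sum_k \sum_(a < m.+1) weight st i k a).
  move=> /badB; rewrite negb_forall => /existsP[k].
  rewrite negb_forall => /existsP[a]; rewrite -ltNge => capped.
  rewrite (bigD1 k) //= (bigD1 a) //= -addrA -[leLHS]addr0 lerD //; last first.
    rewrite addr_ge0 // ?sumr_ge0 // => *; rewrite ?weight_ge0 //.
    by rewrite sumr_ge0 // => *; rewrite weight_ge0.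
  have a1 : (1 : R) <= 2 ^+ a by rewrite exprn_ege1 // ler1n.
  have a0 : (0 : R) < 2 ^+ a by lra.
  rewrite -L_theta /weight mulrC ler_pdivlMr //.
  apply: (@le_trans _ _ ((2 ^+ a * L) `^ theta)).
    rewrite powRM ?(ltW L0) ?(ltW a0) // mulrC ler_wpM2r ?powR_ge0 //.
    exact: le1r_powR.
  apply: ler_powR; last by rewrite ler_pdivlMr // ltW.
  by rewrite mulr_ege1.
have -> : potential st = \sum_i \sum_k expR (- (2 * L / M * volume st k)) *
    \sum_(a < m.+1) weight st i k a.
  rewrite exchange_big; apply: eq_bigr => k _; rewrite -mulr_sumr.
  by rewrite exchange_big.
rewrite (bigID (mem B)) /= -[leLHS]addr0 lerD //; last first.
  apply: sumr_ge0 => i _; apply: sumr_ge0 => k _; rewrite mulr_ge0 ?expR_ge0 //.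
  by apply: sumr_ge0 => a _; apply: weight_ge0.
rewrite mulr_natl -sumr_const; apply: ler_sum => i /weightB wB.
have -> : d%:R ^+ 3 = (d%:R ^+ 2)^-1 * d%:R ^+ 5 :> R by field; rewrite gt_eqF.
apply: (le_trans (ler_wpM2l _ wB)); first by rewrite invr_ge0 exprn_ge0 // ltW.
rewrite mulr_sumr; apply: ler_sum => k _; rewrite ler_wpM2r //.
by apply: sumr_ge0 => a _; apply: weight_ge0.
Qed.

(** The number of bad machines is at most [2 M / d^2 <= M / 2]. *)
Lemma half_below_caps st :
    (forall k, volume st k <= M) -> potential st <= 2 * d%:R * M ->
  (m.+1 <= 2 * #|[set i | below_caps st i]|)%N.
Proof.
move=> volM potM; set G := [set i | _].
have := potential_bad volM (B := ~: G); move=> /(_ _)/le_trans /(_ potM).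
have cardG := cardsC G; rewrite card_ord in cardG.
have d0 : (0 : R) < d%:R by rewrite ltr0n ltnW.
have d2 : (2 : R) <= d%:R by rewrite ler_nat.
have -> : 2 * d%:R * M = 2 * M * d%:R by ring.
rewrite exprSr mulrA ler_pM2r // => bad.
have {}bad : #|~: G|%:R * d%:R ^+ 2 <= 2 * M.
  by apply: bad => i; rewrite !inE.
have d4 : (4 : R) <= d%:R ^+ 2 by nra.
have : #|~: G|%:R * 4 <= 2 * M.
  by apply: le_trans bad; rewrite ler_wpM2l.
by rewrite -!natrM ler_nat; lia.
Qed.

(** The caps hold before a job is placed; a job counted at scale [2^a] adds at most [2^a], hence
    [theta + 1]. *)
Lemma run_invariant p : (forall k, \sum_(v <- p) rel_load v k <= M) ->
  potential (run p) <= 2 * d%:R * M /\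
  forall i k a, (a < m.+1)%N -> capped_load (run p) i k a <= (theta + 1) * 2 ^+ a.
Proof.
elim/last_ind: p => [_|p v IHp volM].
  split=> [|i k a _]; first exact: potential_nil.
  by rewrite /capped_load big_nil mulr_ge0 ?exprn_ge0 //; have := theta_ge1; lra.
have {}volM k : \sum_(v <- p) rel_load v k <= M.
  apply: le_trans (volM k); rewrite -cats1 big_cat big_seq1 lerDl.
  exact: rel_load_ge0.
have [potM caps] := IHp volM.
have [|i iG le_i] := @exists_potential_le (run p) v [set i | below_caps (run p) i].
  by apply: half_below_caps potM => k; rewrite /volume (big_run _ (rel_load^~ k)).
rewrite run_rcons /choose_machine; case: pickP => [j /andP[jG le_j]|/(_ i)]; last first.
  by move: iG; rewrite inE => ->; rewrite le_i.
split=> [|i' k a am]; first exact: le_trans potM.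
rewrite capped_load_rcons /=; case: ifP => [/andP[/eqP <- qa]|_]; last first.
  by rewrite addr0 caps.
have := forallP (forallP jG k) (Ordinal am) => /= cap.
by rewrite mulrDl mul1r lerD.
Qed.

End PotentialRule.

(** * Asymptotics *)

Local Open Scope classical_set_scope.

Lemma ln_le_sqrt (R : realType) (x : R) : 0 < x -> ln x <= 2 * Num.sqrt x.
Proof.
move=> x0; rewrite -{1}(sqr_sqrtr (ltW x0)) lnXn ?sqrtr_gt0 // mulr_natl.
rewrite lerMn2r /= ltW // -{1}[Num.sqrt x](subrK 1) addrC.
rewrite (le_lt_trans (le_ln1Dx _)) //; first by rewrite ltrBDl subrr sqrtr_gt0.
by rewrite ltrBlDl ltrDr.
Qed.

Lemma near_rate_large (R : realType) (K : R) : 0 <= K -> \forall d \near \oo,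
  [/\ 1 < ln (d%:R : R), 1 <= ln (ln (d%:R : R))
    & K <= ln (d%:R : R) / ln (ln d%:R)].
Proof.
move=> K0; near=> d.
(* The square yields [2 K <= sqrt L], hence [K * ln L <= L] as [ln L <= 2 sqrt L]; the summand
   [expR 1] yields [ln L >= 1]. *)
have eL : (2 * K) ^+ 2 + expR 1 <= ln (d%:R : R).
  rewrite -[leLHS]expRK; rewrite ler_ln ?posrE ?expR_gt0 //; last first.
    by rewrite ltr0n; near: d; exact: nbhs_infty_ge.
  by near: d; exact: nbhs_infty_ger.
set L := ln d%:R in eL *.
have K2 : 0 <= (2 * K) ^+ 2 by apply: sqr_ge0.
have eL' : expR 1 <= L by lra.
have L1 : 1 < L by apply: lt_le_trans eL'; rewrite expR_gt1.
have L0 : 0 < L by lra.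
have l1 : 1 <= ln L by rewrite -[leLHS](@expRK R) ler_ln ?posrE ?expR_gt0.
split=> //; rewrite ler_pdivlMr; last lra.
have := ln_le_sqrt L0; set q := Num.sqrt L => lq.
have q0 : 0 <= q by apply: sqrtr_ge0.
have qq : q ^+ 2 = L by rewrite sqr_sqrtr // ltW.
have Kq : 2 * K <= q.
  by rewrite -ler_sqr ?nnegrE ?mulr_ge0 // qq; have := expR_gt0 (1 : R); lra.
by nra.
Unshelve. all: by end_near. Qed.

(** Pulls a constant out of the power at a cost independent of the exponent, which makes the final
    constants uniform in [r]. *)
Lemma ge1_ler_powRM (R : realType) (a x y rho : R) :
  1 <= a -> 0 <= x -> 0 <= y -> 0 <= rho <= 1 -> x <= a * y ->
  x `^ rho <= a * y `^ rho.
Proof.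
move=> a1 x0 y0 /andP[rho0 rho1] xy; have a0 : 0 <= a by lra.
apply: (@le_trans _ _ ((a * y) `^ rho)).
  by apply: ge0_ler_powR; rewrite ?nnegrE ?mulr_ge0.
rewrite powRM // ler_wpM2r ?powR_ge0 //.
by rewrite ler1_powR.
Qed.

(** * Clique size and the lower bound *)

(** Take [s] as the integer part of [a / 22]. Then [(s^21 + 1)^s <= s^(22 s)], whose logarithm
    [22 s ln s] is at most [a * l = ln d]. *)
Lemma clique_size (R : realType) (d : nat) (L l a : R) :
    (0 < d)%N -> ln d%:R = L -> ln L = l -> a * l = L ->
    1 < L -> 1 <= l -> 66 <= a ->
  exists s, [/\ (3 <= s)%N, a <= 44 * s%:R & (((s ^ 7) ^ 3).+1 ^ s <= d)%N].
Proof.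
move=> d0 dL Ll aL L1 l1 a66.
have /truncn_itv/andP[sa as1] : 0 <= a / 22 by lra.
have L0 : 0 < L by lra.
exists (Num.truncn (a / 22)); move: (Num.truncn _) sa as1 => s sa.
rewrite -[s.+1%:R]natr1 => as1.
have s_ge3 : (3 <= s)%N.
  have : (3 : R) < s.+1%:R by rewrite -[s.+1%:R]natr1; lra.
  by rewrite ltr_nat ltnS.
have s1 : (1 : R) <= s%:R by rewrite ler1n; lia.
split; [by []|lra|].
rewrite -expnM (_ : (7 * 3 = 21)%N) //; apply: (@leq_trans ((s ^ 22) ^ s)).
  rewrite leq_exp2r ?(leq_trans _ s_ge3) // (leq_trans (n := 3 * s ^ 21)) //.
    by rewrite (leq_trans (n := 2 * s ^ 21)) ?leq_mul2r ?orbT // mul2n -addnn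
      -addn1 leq_add2l expn_gt0 (leq_trans _ s_ge3).
  by rewrite (expnS _ 21) leq_mul2r s_ge3 orbT.
have s0 : (0 : R) < s%:R by lra.
rewrite -expnM -(ler_nat R) natrX -ler_ln ?posrE ?exprn_gt0 ?ltr0n //.
rewrite lnXn // dL.
have aL' : a <= L by rewrite -aL ler_peMr //; lra.
have sl : ln (s%:R : R) <= l by rewrite -Ll ler_ln ?posrE //; lra.
rewrite -[ln _ *+ _]mulr_natl natrM -aL; apply: ler_pM; rewrite ?mulr_ge0 ?ln_ge0 //.
  by lra.
by rewrite (leq_trans _ s_ge3).
Qed.

Lemma vs_lower_bound (R : realType) : \forall d \near \oo,
  forall (r : R), 1 <= r -> forall (A : vs_algorithm R) (alpha : R),
    vs_competitive A r d alpha -> 44^-1 * vs_rate r d <= alpha.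
Proof.
near=> d.
have [L1 l1 KL] : [/\ 1 < ln (d%:R : R), 1 <= ln (ln (d%:R : R))
    & 66 <= ln (d%:R : R) / ln (ln d%:R)].
  by near: d; apply: near_rate_large.
have d0 : (0 < d)%N by near: d; exact: nbhs_infty_ge.
have [|s [s3 sa sd]] := clique_size d0 erefl erefl _ L1 l1 KL.
  by rewrite divfK // gt_eqF // (lt_le_trans _ l1).
move=> r r1 A alpha Aalpha; have s0 : (0 < s)%N by apply: leq_trans s3.
have s7 : (s ^ 7).-1.+1 = (s ^ 7)%N by rewrite prednK ?expn_gt0 ?s0.
have := @vs_competitive_ge R (s ^ 7).-1 d s r A alpha r1 s0.
rewrite s7 => /(_ _ sd Aalpha)/(le_trans _); apply; last first.
  (* The game is played on [s^7] machines, enough since [18 <= 3^4 <= s^4]. *)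
  apply: (@leq_trans (18 * s ^ 3)); first by rewrite !expnS expn0; nia.
  rewrite (expnD s 4 3) leq_mul2r (leq_trans (n := 3 ^ 4)) ?orbT //.
  by rewrite leq_exp2r.
rewrite mulrC ler_pdivrMr // mulrC; apply: ge1_ler_powRM => //.
- by rewrite ler1n.
- by rewrite (le_trans _ KL).
- have r0 := lt_le_trans ltr01 r1; apply/andP; split.
    by rewrite divr_ge0 ?subr_ge0 // ltW.
  by rewrite ler_pdivrMr // mul1r gerBl.
Unshelve. all: by end_near. Qed.

(** * The upper bound for all norms *)

(* The largest mean machine load in dimension [k] that the normalizations of
   all the L_r norms permit. *)
Definition mean_bound (R : realType) (m d : nat) (T : R -> 'I_d -> R) (k : 'I_d) : R :=
  inf [set T r k / m.+1%:R `^ r^-1 | r in [set r | 1 <= r]].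

Section MeanBound.
Variables (R : realType) (m d : nat) (T : R -> 'I_d -> R) (p : seq 'rV[R]_d).
Hypothesis T_gt0 : forall r k, 1 <= r -> 0 < T r k.
Hypothesis p_ge0 : nonneg_loads p.
Hypothesis p_opt : forall r, 1 <= r -> opt_le1 m.+1 r (normalize (T r) p).
Local Notation M := (m.+1%:R : R).
Local Notation mu := (mean_bound m T).

Let mean_set_neq0 k : [set T r k / M `^ r^-1 | r in [set r | 1 <= r]] !=set0.
Proof. by exists (T 1 k / M `^ 1^-1); exists 1 => //=. Qed.

Let mean_set_lb k : lbound [set T r k / M `^ r^-1 | r in [set r | 1 <= r]] 0.
Proof. by move=> _ [r /= r1 <-]; rewrite divr_ge0 ?powR_ge0 // ltW // T_gt0. Qed.

Lemma mean_bound_ge0 k : 0 <= mu k.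
Proof. exact: lb_le_inf. Qed.

Lemma mean_bound_le r k : 1 <= r -> mu k <= T r k / M `^ r^-1.
Proof. by move=> r1; apply: ge_inf; [exists 0 | exists r]. Qed.

Lemma normalize_nonneg r : 1 <= r -> nonneg_loads (normalize (T r) p).
Proof.
move=> r1 _ /mapP[v vp ->] k; rewrite mxE divr_ge0 ?p_ge0 // ltW //.
exact: T_gt0.
Qed.

Lemma total_load_le_mean_bound k : \sum_(v <- p) v 0 k <= M * mu k.
Proof.
rewrite mulrC -ler_pdivrMr ?ltr0n //; apply: lb_le_inf => // _ [r /= r1 <-].
have := opt_le1_volume k r1 (normalize_nonneg r1) (p_opt r1).
rewrite big_map; under eq_bigr do rewrite mxE.
rewrite -mulr_suml ler_pdivrMr ?T_gt0 // => volT.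
rewrite ler_pdivrMr ?ltr0n //; apply: le_trans volT _.
by rewrite mulrAC [M * _]mulrC mulrAC.
Qed.

(** If [mu k = 0], the total load in dimension [k] vanishes, so division by zero loses nothing. *)
Lemma rel_load_mean_bound v k : v \in p -> mu k * rel_load mu v k = v 0 k.
Proof.
move=> vp; rewrite /rel_load ger0_norm ?p_ge0 //.
have [mu0|mu0] := eqVneq (mu k) 0; last by rewrite mulrC divfK.
rewrite mu0 mul0r; apply/esym/eqP; rewrite eq_le p_ge0 // andbT.
have := total_load_le_mean_bound k; rewrite mu0 mulr0; apply: le_trans.
rewrite (big_rem v) //= lerDl big_seq sumr_ge0 // => u /mem_rem up.
exact: p_ge0.
Qed.

Lemma sum_rel_load_le k : \sum_(v <- p) rel_load mu v k <= M.
Proof.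
have := total_load_le_mean_bound k.
have [mu0 _|mu0] := eqVneq (mu k) 0.
  by rewrite big1 // => v _; rewrite /rel_load mu0 invr0 mulr0.
have mu_gt0 : 0 < mu k by rewrite lt0r mu0 mean_bound_ge0.
rewrite mulrC -ler_pdivrMl // mulr_sumr; apply: le_trans.
rewrite [leLHS]big_seq [leRHS]big_seq; apply: ler_sum => v vp.
by rewrite -(rel_load_mean_bound k vp) mulKf.
Qed.

Lemma load_norm_potential_rule (L theta r : R) k :
    1 <= L -> (2 <= d)%N -> expR L = d%:R -> 1 <= theta ->
    L `^ theta = d%:R ^+ 5 -> 1 <= r ->
  load_norm r (normalize (T r) p)
    (online_assignment (potential_rule m mu L theta) p) k
  <= (4 * (4 * (theta + 1)) `^ (r - 1)) `^ r^-1.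
Proof.
move=> L1 d2 eL th1 Lth r1; have r0 : 0 < r := lt_le_trans ltr01 r1.
have [_ caps] := run_invariant mean_bound_ge0 L1 d2 eL th1 Lth sum_rel_load_le.
set th := theta + 1; have th2 : 1 <= th by rewrite /th lerDr (le_trans ler01).
set A := potential_rule m mu L theta; set st := run m mu L theta p in caps.
(* [nu] converts relative loads into loads normalized for [L_r]. *)
pose q := rel_load mu; pose nu := mu k / T r k.
have T0 : 0 < T r k by apply: T_gt0.
have nu0 : 0 <= nu by rewrite divr_ge0 ?mean_bound_ge0 // ltW.
have q0 (x : 'rV[R]_d * 'I_m.+1) : 0 <= q x.1 k.
  by apply: rel_load_ge0; apply: mean_bound_ge0.
have nuq v : v \in p -> nu * q v k = v 0 k / T r k.
  by move=> vp; rewrite /nu mulrAC rel_load_mean_bound.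
have stp x : x \in st -> x.1 \in p.
  have : [seq y.1 | y <- st] = p.
    rewrite /st; elim/last_ind: p => // p' v IHp.
    by rewrite run_rcons map_rcons IHp.
  by move=> <-; apply: map_f.
have load_st i : machine_load (normalize (T r) p) (online_assignment A p) i k
    = nu * \sum_(x <- st | x.2 == i) q x.1 k.
  rewrite mulr_sumr big_seq_cond.
  rewrite (eq_bigr (fun x : 'rV[R]_d * 'I_m.+1 => x.1 0 k / T r k)); last first.
    by move=> x /andP[/stp/nuq].
  rewrite -big_seq_cond -(big_run_machine mu L theta p i (fun v => v 0 k / T r k)).
  rewrite /machine_load size_map; apply: eq_bigr => j _.
  by rewrite (nth_map 0) // mxE.
apply: ge0_ler_powR; rewrite ?nnegrE ?mulr_ge0 ?powR_ge0 ?invr_ge0 ?(ltW r0) //.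
  by apply: sumr_ge0 => i _; apply: powR_ge0.
have by_machine (F : 'rV[R]_d * 'I_m.+1 -> R) :
    \sum_i \sum_(x <- st | x.2 == i) F x = \sum_(x <- st) F x.
  by rewrite [RHS](partition_big (fun x => x.2) xpredT).
have vol : \sum_i \sum_(x <- st | x.2 == i) q x.1 k <= M.
  by rewrite by_machine (big_run m mu L theta p (q^~ k)); apply: sum_rel_load_le.
have volr : \sum_i \sum_(x <- st | x.2 == i) (nu * q x.1 k) `^ r <= 1.
  rewrite by_machine (big_run m mu L theta p (fun v => (nu * q v k) `^ r)).
  have := opt_le1_sum_powR k r1 (normalize_nonneg r1) (p_opt r1).
  apply: le_trans; rewrite big_map [leLHS]big_seq [leRHS]big_seq.
  by apply: ler_sum => v /nuq ->; rewrite mxE.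
(* [mu k] is at most [T r k / M^(1/r)], so the mean terms sum to at most 1 over the machines. *)
have nuM : nu `^ r * M <= 1.
  have M0 : 0 < M by rewrite ltr0n.
  have : nu <= M^-1 `^ r^-1.
    rewrite /nu ler_pdivrMr // -powR_inv1 ?(ltW M0) // powRAC powR_inv1 ?powR_ge0 //.
    by rewrite mulrC; apply: mean_bound_le.
  move=> nuM; rewrite -ler_pdivlMr // mul1r.
  have -> : M^-1 = (M^-1 `^ r^-1) `^ r.
    by rewrite -powRrM mulVf ?gt_eqF // powRr1 // invr_ge0 ltW.
  by apply: ge0_ler_powR; rewrite ?nnegrE ?powR_ge0 // ltW.
pose D : R := 2 * (4 * th) `^ (r - 1).
have D0 : 0 <= D by rewrite mulr_ge0 ?powR_ge0.
have machine i : machine_load (normalize (T r) p) (online_assignment A p) i k `^ r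
    <= D * (nu `^ r * \sum_(x <- st | x.2 == i) q x.1 k +
            \sum_(x <- st | x.2 == i) (nu * q x.1 k) `^ r).
  rewrite load_st powRM // ?sumr_ge0 //.
  under [X in _ + X]eq_bigr do rewrite powRM //.
  rewrite -mulr_sumr -mulrDr mulrCA ler_wpM2l ?powR_ge0 //.
  apply: (capped_sum_powR (N := m.+1)) => //; last by move=> a /(caps i k).
  apply: le_trans vol; rewrite [leRHS](bigD1 i) //= lerDl.
  by apply: sumr_ge0 => j _; apply: sumr_ge0.
apply: le_trans (ler_sum _ (fun i _ => machine i)) _.
rewrite -mulr_sumr big_split /= -mulr_sumr.
have -> : 4 * (4 * th) `^ (r - 1) = D * (1 + 1) by rewrite /D; ring.
apply: ler_wpM2l => //; apply: lerD => //.
by apply: le_trans nuM; rewrite ler_wpM2l ?powR_ge0.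
Qed.

End MeanBound.

(** The factor [5 * (L / ln L)] is the [theta] with [L^theta = d^5]. *)
Definition vsall_potential_rule (R : realType) : vsall_algorithm R :=
  fun m d T => let L := ln d%:R in
    potential_rule m (mean_bound m T) L (5 * (L / ln L)).

Lemma vsall_upper_bound (R : realType) : \forall d \near \oo,
  vsall_competitive (@vsall_potential_rule R) d (fun r => 96 * vs_rate r d).
Proof.
near=> d => m T p T0 p0 popt r k r1.
have [L1 l1 A1] : [/\ 1 < ln (d%:R : R), 1 <= ln (ln (d%:R : R))
    & 1 <= ln (d%:R : R) / ln (ln d%:R)].
  by near: d; apply: near_rate_large.
have d2 : (2 <= d)%N by near: d; exact: nbhs_infty_ge.
rewrite /vs_rate /vsall_potential_rule.
have expL : expR (ln d%:R) = d%:R :> R by rewrite lnK // posrE ltr0n ltnW.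
move: L1 l1 A1 expL; set L := ln d%:R; set l := ln L; set A := L / l.
clearbody L => L1 l1 A1 expL.
have r0 : 0 < r := lt_le_trans ltr01 r1.
have Lth : L `^ (5 * A) = d%:R ^+ 5.
  have l0 : 0 < l := lt_le_trans ltr01 l1.
  rewrite /powR gt_eqF ?(lt_trans ltr01) // -/l /A mulrA divfK ?gt_eqF //.
  by rewrite expRM_natl expL.
have := load_norm_potential_rule T0 p0 popt k (ltW L1) d2 expL _ Lth r1.
move=> /(_ _)/le_trans; apply; first lra.
(* One factor 4 bounds [4^(1/r)]; 24 comes from [4 (5 A + 1) <= 24 A]. *)
rewrite powRM ?powR_ge0 // -powRrM -[96]/(4 * 24)%:R natrM -mulrA.
have rho : 0 <= (r - 1) / r <= 1.
  apply/andP; split; first by rewrite divr_ge0 ?subr_ge0 // ltW.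
  by rewrite ler_pdivrMr // mul1r gerBl.
apply: ler_pM; rewrite ?powR_ge0 //.
  by rewrite ler1_powR ?ler1n // invf_le1.
by apply: ge1_ler_powRM => //; lra.
Unshelve. all: by end_near. Qed.

Theorem theorem3 (R : realType) :
  (exists A : vsall_algorithm R, exists2 C : R, 0 < C &
     \forall d \near \oo, vsall_competitive A d (fun r => C * vs_rate r d))
  /\
  (forall r : R, 1 <= r -> exists2 c : R, 0 < c &
     \forall d \near \oo, forall (A : vs_algorithm R) (alpha : R),
       vs_competitive A r d alpha -> c * vs_rate r d <= alpha).
Proof.
split.
  exists (@vsall_potential_rule R), 96 => //; exact: vsall_upper_bound.
move=> r r1; exists 44^-1; first by rewrite invr_gt0.
near=> d => A alpha; move: r1 A alpha; move: r; near: d.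
exact: vs_lower_bound.
Unshelve. all: by end_near. Qed.
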